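(* If $n=(q+1)^2+1$ for some odd prime power $q$, then $$M(n)\geq\bigl(n-\sqrt{n-1}\bigr)^2=n^2-O(n^{3/2}).$$
   Context: $S_n$ is the symmetric group on $[n]=\{1,\dots,n\}$. For $\sigma,\pi\in S_n$, $\sigma\cap\pi=\{i\in[n]:\sigma(i)=\pi(i)\}$. A family $\mathcal{F}\subseteq S_n$ is even-intersecting if $|\sigma\cap\pi|$ is even for every two distinct $\sigma,\pi\in\mathcal{F}$. $M(n)=\max\{|\mathcal{F}|:\mathcal{F}\subseteq S_n\text{ is even-intersecting}\}$. *)

(* Defs.v *)
From mathcomp Require Import all_boot all_order all_fingroup.

Set Implicit Arguments.
Unset Strict Implicit.
Unset Printing Implicit Defensive.

(* [n] is represented by 'I_n = {0, ..., n-1}, so S_n is {perm 'I_n}. *)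
Definition agreement n (s t : 'S_n) : {set 'I_n} := [set i | s i == t i].

Definition even_intersecting n (F : {set 'S_n}) : bool :=
  [forall s in F, forall t in F, (s != t) ==> ~~ odd #|agreement s t|].

Definition M n : nat := \max_(F : {set 'S_n} | even_intersecting F) #|F|.

Definition prime_power q : Prop :=
  exists p k : nat, [/\ prime p, 0 < k & q = p ^ k].

(* Main.v *)
Require Import Defs.
From mathcomp Require Import all_boot all_order all_algebra.
From mathcomp Require Import all_fingroup all_solvable all_field.
From mathcomp Require Import all_classical all_reals all_analysis.
From mathcomp Require Import zify ring lra.

Import Order.TTheory GRing.Theory Num.Theory.
Import numFieldNormedType.Exports.

(** Since [n - sqrt (n - 1) = q ^ 2 + q + 1], the lower bound asks for one
    permutation for each ordered pair of points of a projective plane of order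
    [q]; and [n] is the number of points of the plane plus the [q + 1] points of
    one line.

    Let [G] be a group acting simply transitively on the points of the plane
    and let [A] be a line, seen as a subset of [G] whose translates are the
    lines.  On the disjoint union of [G] and a copy of [A], consider the
    permutation which, for a pair [(a, b)], sends the line [a *: A] to the copy
    of [A] and the copy to the line [b *: A], in both cases by translation, and
    moves the points outside [a *: A] by left multiplication by [b * a^-1]
    ([exchange_perm]).  Compare the permutations of two distinct pairs.  On the
    copy of [A] they agree everywhere or nowhere.  If [a = a'], then they agree
    on the whole line [a *: A], and nowhere off it because [b] differs from
    [b'].  Otherwise they agree nowhere on the lines [a *: A] and [a' *: A],
    and off both lines everywhere or nowhere.  A line has [q + 1] points, an
    even number because [q] is odd; two distinct lines meet in one point, so
    [q ^ 2 + q + 1 - 2 * (q + 1) + 1 = q ^ 2 - q] points avoid both, again an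
    even number.  Hence the [(q ^ 2 + q + 1) ^ 2] permutations are
    even-intersecting.  The argument sees the line only through these parities,
    and [M_difference_set] is stated for any subset that has them.

    Such a pair [(G, A)] is the Singer difference set: [G] is the
    multiplicative group of the field [K] of order [q ^ 3] modulo that of its
    subfield of order [q], and [A] is the image of the elements of trace zero.
    The sizes come from polynomial degree bounds for the trace
    ([card_sum_trace_fibers]), and the intersection of two lines from an
    explicit solution of a pair of trace equations ([trace0_translate]).

    The asymptotic estimate follows from
    [n ^ 2 - (n - s) ^ 2 = 2 * n * s - s ^ 2] with [s = sqrt (n - 1)]. *)

(** * Reduction to an arbitrary finite ground set *)

(** The number of agreements does not depend on how the ground set is labelled,
    so even-intersecting families may be built on any finite type. *)
Lemma M_lower_bound (T : finType) (F : {set {perm T}}) :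
  (forall s t, s \in F -> t \in F -> s != t ->
     ~~ odd #|[set x | s x == t x]|) ->
  #|F| <= M #|T|.
Proof.
move=> evenF.
have conj_inj (s : {perm T}) :
    injective (fun i : 'I_#|T| => enum_rank (s (enum_val i))).
  by move=> i j /enum_rank_inj/perm_inj/enum_val_inj.
pose h s := perm (conj_inj s).
have h_inj : injective h.
  move=> s t st; apply/permP => x; apply: enum_rank_inj.
  by move/permP/(_ (enum_rank x)): st; rewrite !permE !enum_rankK.
have -> : #|F| = #|h @: F| by rewrite card_imset.
rewrite /M.
apply: (@leq_bigmax_cond _ (@even_intersecting #|T|) (fun G : {set 'S_#|T|} => #|G|)).
apply/forall_inP => _ /imsetP[s sF ->]; apply/forall_inP => _ /imsetP[t tF ->].
apply/implyP => st; have {}st : s != t by apply: contraNneq st => ->.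
suff -> : agreement (h s) (h t) = enum_rank @: [set x | s x == t x].
  by rewrite card_imset ?evenF //; apply: enum_rank_inj.
apply/setP => i; rewrite inE !permE (inj_eq enum_rank_inj).
by rewrite -[i in RHS]enum_valK mem_imset ?inE//; apply: enum_rank_inj.
Qed.

(** * Exchange permutations of a subset of a group *)

Section DifferenceSet.
Variables (gT : finGroupType) (A : {set gT}).
Local Open Scope group_scope.

(** The second summand is a copy of [A] disjoint from the group; it is the
    fixed set through which the permutations below exchange two translates. *)
Let T := (gT + {x | x \in A})%type.

Definition translate (a : gT) (z : T) : T :=
  match z with inl x => inl (a * x) | inr d => inr d end.

Lemma translate_inj a : injective (translate a).
Proof. by case=> [x|d] [y|e] //= [] // /mulgI->. Qed.

Definition swap (z : T) : T :=
  match z with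
  | inl x => if insub x is Some d then inr d else inl x
  | inr d => inl (val d)
  end.

Lemma swap_inj : injective swap.
Proof.
have swapK : involutive swap.
  case=> [x|d] /=; last by rewrite valK.
  by case: insubP => [d _ <-|/negbTE xA] //=; rewrite insubF.
exact: inv_inj.
Qed.

Definition translation a : {perm T} := perm (@translate_inj a).

(** With [ab = (a, b)], this maps [a *: A] onto the copy of [A], the copy onto
    [b *: A], and the complement of [a *: A] onto that of [b *: A] by left
    multiplication by [b * a^-1].  Writing it as a product of three bijections
    makes it a permutation at no cost. *)
Definition exchange_perm (ab : gT * gT) : {perm T} :=
  (translation ab.1)^-1 * perm swap_inj * translation ab.2.

Lemma translationV a : (translation a)^-1 = translation a^-1.
Proof.
apply/permP => z; apply: (@perm_inj _ (translation a)).
by rewrite permKV !permE; case: z => [x|d] //=; rewrite mulKVg.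
Qed.

Lemma exchange_perm_inl a b x :
  exchange_perm (a, b) (inl x) =
    if insub (a^-1 * x) is Some d then inr d else inl (b * (a^-1 * x)).
Proof.
by rewrite /exchange_perm translationV !permM !permE /=; case: insubP.
Qed.

Lemma exchange_perm_inr a b d : exchange_perm (a, b) (inr d) = inl (b * val d).
Proof. by rewrite /exchange_perm translationV !permM !permE. Qed.

(** The images of [inr d] and the preimage of [inr d], for a single [d] in
    [A], already determine [b] and [a]. *)
Lemma exchange_perm_inj d : d \in A -> injective exchange_perm.
Proof.
move=> dA [a b] [a' b'] E; pose d' : {x | x \in A} := Sub d dA.
have := congr1 (fun s : {perm T} => s (inr d')) E.
rewrite !exchange_perm_inr => -[/mulIg <-].
have := congr1 (fun s : {perm T} => s (inl (a * d))) E.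
rewrite !exchange_perm_inl mulKg (insubT (fun x => x \in A) dA).
case: insubP => // e _ ee [dd]; congr (_, _); apply/invg_inj/(mulIg (a * d)).
by rewrite mulKg -ee -dd.
Qed.

(** Two exchange permutations agree at a group element in one of two ways:
    both send it to the same point of the copy of [A], which forces [a = a'],
    or both move it by the same left multiplication.  The boolean is written
    as a sum of these exclusive cases so that it can be summed over [x]. *)
Lemma exchange_perm_inl_eq a b a' b' x :
  (exchange_perm (a, b) (inl x) == exchange_perm (a', b') (inl x)) =
  ((a == a') * ((a^-1 * x)%g \in A) +
   ((b * a^-1)%g == (b' * a'^-1)%g) *
     ((a^-1 * x \notin A)%g && (a'^-1 * x \notin A)%g))%N :> nat.
Proof.
rewrite !exchange_perm_inl.
case: insubP => [d dA dE|dA]; case: insubP => [e eA eE|eA].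
- rewrite dA /= muln0 addn0 muln1 (inj_eq inr_inj) -val_eqE /= dE eE.
  by rewrite (inj_eq (mulIg x)) (inj_eq invg_inj).
- rewrite dA /= muln0 addn0 muln1.
  by case: eqP eA dA => // -> /negbTE ->.
- by rewrite (negbTE dA) eA /= !muln0.
- by rewrite (negbTE dA) eA /= muln0 muln1 (inj_eq inl_inj) !mulgA (inj_eq (mulIg x)).
Qed.

(** The three terms count the agreements landing in the copy of [A], those
    starting from the copy of [A], and those outside both translates. *)
Lemma card_agreement a b a' b' :
  #|[set z | exchange_perm (a, b) z == exchange_perm (a', b') z]| =
  ((a == a') * #|A| + (b == b') * #|A| +
   ((b * a^-1)%g == (b' * a'^-1)%g) *
     #|[set x | (a^-1 * x \notin A)%g && (a'^-1 * x \notin A)%g]|)%N.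
Proof.
rewrite -sum1dep_card big_mkcond big_sumType /=.
have -> : (\sum_d (if exchange_perm (a, b) (inr d) == exchange_perm (a', b') (inr d)
    then 1 else 0) = (b == b') * #|A|)%N.
  under eq_bigr => d _ do
    rewrite !exchange_perm_inr (inj_eq inl_inj) (inj_eq (mulIg _)).
  by rewrite sum_nat_const card_sig mulnC; case: (_ == _).
under eq_bigr => x _ do
  rewrite -[if _ then _ else _]/(nat_of_bool _) exchange_perm_inl_eq.
rewrite big_split /= -!big_distrr /= -!big_mkcond /= !sum1dep_card.
have -> : #|[set x | (a^-1 * x)%g \in A]| = #|A|.
  by rewrite -(card_lcoset A a); apply: eq_card => x; rewrite inE mem_lcoset.
by rewrite -!addnA [X in (_ + X)%N]addnC.
Qed.

(** These parities are those of the lines of a projective plane of odd order: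
    evenly many points in each line, an odd number of points in all, and one
    common point for two distinct lines. *)
Hypothesis even_A : ~~ odd #|A|.
Hypothesis odd_gT : odd #|gT|.
Hypothesis odd_translate :
  forall c, c != 1 -> odd #|[set x in A | (c * x)%g \in A]|.

(** By inclusion-exclusion the union of the two translates has
    [2 * #|A| - odd] elements, an odd number, as is the order of the group. *)
Lemma even_outside_translates a a' : a != a' ->
  ~~ odd #|[set x | (a^-1 * x \notin A)%g && (a'^-1 * x \notin A)%g]|.
Proof.
move=> aa'.
have -> : [set x | (a^-1 * x \notin A)%g && (a'^-1 * x \notin A)%g] =
    ~: ((a *: A) :|: (a' *: A)).
  by apply/setP => x; rewrite !inE !mem_lcoset negb_or.
have cap : odd #|(a *: A) :&: (a' *: A)|.
  have -> : (a *: A) :&: (a' *: A) =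
      a *: [set x in A | (a'^-1 * a * x)%g \in A].
    by apply/setP => x; rewrite !(inE, mem_lcoset) !mulgA mulgK.
  rewrite card_lcoset; apply: odd_translate.
  by apply: contraNneq aa' => /(canRL (mulKVg _)); rewrite mulg1 => ->.
have := cardsC ((a *: A) :|: (a' *: A)).
have := cardsUI (a *: A) (a' *: A).
rewrite !card_lcoset => /(congr1 odd) + /(congr1 odd).
by rewrite !oddD cap (negbTE even_A) odd_gT /= addbT => /negbFE->/=/negbRL ->.
Qed.

(** If [a = a'], then [b] differs from [b'], so the last factor in
    [card_agreement] vanishes and only an even multiple of [#|A|] remains. *)
Lemma even_exchange_agreement ab ab' : ab != ab' ->
  ~~ odd #|[set z | exchange_perm ab z == exchange_perm ab' z]|.
Proof.
case: ab ab' => [a b] [a' b']; rewrite card_agreement !oddD !oddM (negbTE even_A).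
rewrite !andbF /=; case: (eqVneq a a') => [->|aa' _]; last first.
  by rewrite (negbTE (even_outside_translates _ _ aa')) andbF.
by rewrite (inj_eq (mulIg _)) xpair_eqE eqxx /= => /negbTE->.
Qed.

Lemma M_difference_set : 0 < #|A| -> #|gT| ^ 2 <= M (#|gT| + #|A|).
Proof.
case/card_gt0P => d dA.
have -> : (#|gT| + #|A|)%N = #|{: T}| by rewrite card_sum card_sig.
have -> : (#|gT| ^ 2)%N = #|[set exchange_perm ab | ab in [set: gT * gT]]|.
  by rewrite card_imset ?cardsT ?card_prod //; apply: exchange_perm_inj dA.
apply: M_lower_bound => _ _ /imsetP[ab _ ->] /imsetP[ab' _ ->] ne.
by apply: even_exchange_agreement; apply: contraNneq ne => ->.
Qed.
End DifferenceSet.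

(** * Elements of trace zero in a cubic extension *)

Section Trace.
Variables (K : finFieldType) (q : nat).
Hypothesis q_gt1 : (1 < q)%N.
Hypothesis cardK : #|K| = (q ^ 3)%N.
(** The [q]-power map is additive because [q] is a power of the
    characteristic.  The subfield of order [q] appears only as the set of
    fixed points of this map, which avoids a tower of fields. *)
Hypothesis FrobD : forall x y : K, ((x + y) ^+ q = x ^+ q + y ^+ q)%R.
Local Open Scope ring_scope.

Let frob (x : K) : K := x ^+ q.
Definition trace (x : K) : K := x + frob x + frob (frob x).

Lemma frobM x y : frob (x * y) = frob x * frob y.
Proof. exact: exprMn. Qed.

Lemma frobD x y : frob (x + y) = frob x + frob y.
Proof. exact: FrobD. Qed.

Lemma frobB x y : frob (x - y) = frob x - frob y.
Proof. by apply: (addIr (frob y)); rewrite -frobD !subrK. Qed.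

Lemma frob3 x : frob (frob (frob x)) = x.
Proof. by rewrite /frob -!exprM -[in RHS](expf_card x) cardK; congr (_ ^+ _); lia. Qed.

Lemma frob_trace x : frob (trace x) = trace x.
Proof. by rewrite /trace !frobD frob3 addrC addrA. Qed.

Lemma traceZ e x : frob e = e -> trace (e * x) = e * trace x.
Proof. by move=> eF; rewrite /trace !frobM !eF !mulrDr. Qed.

Lemma card_roots_le (p : {poly K}) (S : {set K}) :
  p != 0 -> (forall x, x \in S -> root p x) -> (#|S| < size p)%N.
Proof.
move=> p0 rS; rewrite cardE; apply: max_poly_roots (enum_uniq _) => //.
by apply/allP => x; rewrite mem_enum => /rS.
Qed.

Lemma card_fixed_le : (#|[set x | frob x == x]| <= q)%N.
Proof.
have sz : size ('X^q - 'X : {poly K}) = q.+1.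
  by rewrite size_polyDl ?size_polyXn // size_polyN size_polyX ltnS.
rewrite -ltnS -sz; apply: card_roots_le => [|x].
  by rewrite -size_poly_eq0 sz.
by rewrite inE rootE !hornerE subr_eq0.
Qed.

Lemma card_trace_fiber_le t : (#|[set x | trace x == t]| <= q ^ 2)%N.
Proof.
pose p : {poly K} := 'X^(q ^ 2) + ('X^q + ('X - t%:P)).
have sz1 : size ('X^q + ('X - t%:P) : {poly K}) = q.+1.
  by rewrite size_polyDl ?size_polyXn // size_XsubC ltnS.
have sz : size p = (q ^ 2).+1.
  by rewrite size_polyDl ?size_polyXn // sz1 ltnS -[X in (X < _)%N](expn1 q) ltn_exp2l.
rewrite -ltnS -sz; apply: card_roots_le => [|x].
  by rewrite -size_poly_eq0 sz.
rewrite inE rootE !hornerE /trace /frob => /eqP <-.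
by apply/eqP; rewrite -exprM mulnn /=; ring.
Qed.

(** The trace takes its values in the fixed field, where polynomial degrees
    bound both the number of values by [q] and each fibre by [q ^ 2].  Since the
    fibres fill the [q ^ 3] elements of [K], both bounds are attained; this
    yields [card_fixed] and [card_trace0]. *)
Lemma card_sum_trace_fibers :
  (\sum_(t in [set x | frob x == x]) #|[set x | trace x == t]| = q ^ 3)%N.
Proof.
rewrite -cardK -[RHS]sum1_card
  [RHS](partition_big trace (fun t => t \in [set x | frob x == x])) /=.
  by apply: eq_bigr => t _; rewrite sum1dep_card.
by move=> x _; rewrite inE frob_trace.
Qed.

Lemma card_fixed : #|[set x | frob x == x]| = q.
Proof.
apply/eqP; rewrite eqn_leq card_fixed_le /=.
rewrite -(@leq_pmul2r (q ^ 2)) ?expn_gt0 ?(ltnW q_gt1) // -expnS.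
rewrite -card_sum_trace_fibers -sum_nat_const.
by apply: leq_sum => t _; apply: card_trace_fiber_le.
Qed.

Lemma card_trace0 : #|[set x | trace x == 0]| = (q ^ 2)%N.
Proof.
apply/eqP; rewrite eqn_leq card_trace_fiber_le /=.
have F0 : 0 \in [set x : K | frob x == x].
  by rewrite inE /frob expr0n; case: q q_gt1.
have := card_sum_trace_fibers; rewrite (big_setD1 0) //=.
have : (\sum_(t in [set x | frob x == x] :\ 0%R) #|[set x | trace x == t]|
    <= (q - 1) * q ^ 2)%N.
  have -> : (q - 1)%N = #|[set x | frob x == x] :\ 0|.
    by rewrite -[in LHS]card_fixed (cardsD1 0) F0 addKn.
  rewrite -sum_nat_const; apply: leq_sum => t _; exact: card_trace_fiber_le.
rewrite mulnBl mul1n -expnS.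
have q23 : (q ^ 2 <= q ^ 3)%N by rewrite leq_exp2l.
move=> le1 /(canRL (addnK _)) ->.
by rewrite -[leqLHS](subKn q23); apply: leq_sub2l.
Qed.

(** Two distinct lines of the plane meet in exactly one point.  The equations
    [trace y = 0] and [trace (d * y) = 0] say that the vector of conjugates of
    [y] is orthogonal to [(1, 1, 1)] and to the conjugates of [d], so it is
    proportional to their cross product, whose entries are up to sign the
    conjugates of [frob d - frob (frob d)]. *)
Lemma trace0_translate d : frob d != d ->
  exists2 y0, y0 != 0 /\ trace y0 = 0 /\ trace (d * y0) = 0 &
    forall y, trace y = 0 -> trace (d * y) = 0 ->
      exists2 e, frob e = e & y = e * y0.
Proof.
move=> dF; set y0 := frob d - frob (frob d).
have y00 : y0 != 0.
  rewrite /y0 -frobB; apply: contraNneq dF => /eqP.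
  by rewrite expf_eq0 subr_eq0 => /andP[_ /eqP <-].
exists y0.
  split=> //; split; first by rewrite /trace /y0 !frobB !frob3; ring.
  by rewrite /trace /y0 !frobM !frobB !frob3; ring.
move=> y ty tdy.
(* A two by two minor of the conjugate vectors of [y] and [y0]: eliminating
   the third conjugate of [y] between the two trace equations makes it vanish. *)
have key : frob y * y0 = frob y0 * y.
  rewrite /y0 frobB frob3; apply/eqP; rewrite -subr_eq0.
  have -> : frob y * (frob d - frob (frob d)) - (frob (frob d) - d) * y =
     trace (d * y) - frob (frob d) * trace y.
    by rewrite /trace !frobM; ring.
  by rewrite ty tdy mulr0 subrr.
exists (y / y0); last by rewrite divfK.
have fy00 : frob y0 != 0 by rewrite expf_neq0.
apply: (mulIf fy00); rewrite -frobM divfK //.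
by apply: (mulIf y00); rewrite key mulrAC divfK // mulrC.
Qed.

Lemma card_unit_set (P : pred K) : P 0 ->
  #|[set x | P x]| = #|[set u : {unit K} | P (val u)]|.+1.
Proof.
move=> P0; rewrite (cardsD1 0) inE P0 add1n; congr _.+1.
rewrite -(card_imset _ val_inj); apply: eq_card => x; rewrite !inE.
apply/andP/imsetP => [[x0 Px]|[u]].
  have ux : x \is a GRing.unit by rewrite unitfE.
  by exists (Sub x ux); rewrite ?inE ?SubK.
by rewrite inE => Pu ->; rewrite Pu -unitfE (valP u).
Qed.

(** * The Singer difference set *)

(** The units of the subfield of order [q]; its cosets are the points of the
    projective plane over that subfield. *)
Definition base_units : {set {unit K}} := [set u | frob (val u) == val u].
Definition trace0_units : {set {unit K}} := [set u | trace (val u) == 0].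

Lemma frob0 : frob 0 = 0.
Proof. by rewrite /frob expr0n gtn_eqF // ltnW. Qed.

Lemma base_units_group_set : group_set base_units.
Proof.
apply/group_setP; split=> [|u v]; rewrite !inE ?/frob ?expr1n // => /eqP uF /eqP vF.
by rewrite FinRing.val_unitM exprMn uF vF.
Qed.
Canonical base_units_group := Group base_units_group_set.

Lemma card_base_units : #|base_units| = (q - 1)%N.
Proof.
by rewrite -card_fixed (card_unit_set (fun x => frob x == x)) ?frob0 // subn1.
Qed.

Lemma card_trace0_units : #|trace0_units| = (q ^ 2 - 1)%N.
Proof.
rewrite -card_trace0 (card_unit_set (fun x => trace x == 0)) ?subn1 //.
by rewrite /trace !frob0 !addr0.
Qed.

Lemma base_units_norm u : u \in ('N(base_units))%g.
Proof.
have /(@sub_abelian_norm _ _ base_units) : abelian [set: {unit K}].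
  exact: cyclic_abelian (field_unit_group_cyclic _).
by move/(_ (finset.subsetT _))/fintype.subsetP; apply; rewrite inE.
Qed.

(** The line of trace-zero points.  Testing one representative is enough since
    the trace is homogeneous over the subfield, see [coset_singer]. *)
Definition singer_set : {set coset_of base_units} :=
  [set X : coset_of base_units | repr X \in trace0_units].

Lemma coset_singer u : (coset base_units u \in singer_set) = (u \in trace0_units).
Proof.
rewrite inE; have := mem_repr_coset (coset base_units u).
rewrite val_coset ?base_units_norm // => /rcosetP[e]; rewrite inE => /eqP eF ->.
by rewrite !inE FinRing.val_unitM traceZ // mulf_eq0 -[_ == 0]negbK -unitfE (valP e).
Qed.

Lemma card_coset_preim (B : {set coset_of base_units}) :
  #|[set u | coset base_units u \in B]| = (#|B| * #|base_units|)%N.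
Proof.
rewrite -sum1_card (partition_big (coset base_units) (fun X => X \in B)) /=; last first.
  by move=> u; rewrite inE.
rewrite -sum_nat_const; apply: eq_bigr => X XB; rewrite sum1dep_card.
rewrite -(card_rcoset base_units (repr X)) -val_coset ?base_units_norm // coset_reprK.
apply: eq_card => u; rewrite !inE; apply/andP/idP => [[_ /eqP <-]|uX].
  by rewrite val_coset ?base_units_norm // rcoset_refl.
by rewrite (coset_mem uX) XB.
Qed.

Lemma card_singer_group : #|{: coset_of base_units}| = (q ^ 2 + q + 1)%N.
Proof.
have := card_coset_preim [set: coset_of base_units]; rewrite !cardsT card_base_units.
have -> : #|[set u | coset base_units u \in [set: coset_of base_units]]| = (q ^ 3 - 1)%N.
  by rewrite -cardK subn1 -card_finField_unit; apply: eq_card => u; rewrite !inE.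
move=> cardG; apply/eqP.
have q1 : (0 < q - 1)%N by rewrite subn_gt0.
rewrite -(eqn_pmul2r q1) -cardG; apply/eqP.
by case: (q) q_gt1 => // r _; rewrite !subn1 /= !expnS; lia.
Qed.

Lemma card_singer_set : #|singer_set| = (q + 1)%N.
Proof.
have := card_coset_preim singer_set; rewrite card_base_units.
have -> : [set u | coset base_units u \in singer_set] = trace0_units.
  by apply/setP => u; rewrite finset.in_set coset_singer.
rewrite card_trace0_units => cardA; apply/eqP.
have q1 : (0 < q - 1)%N by rewrite subn_gt0.
by rewrite -(eqn_pmul2r q1) -cardA -(exp1n 2) subn_sqr mulnC.
Qed.

(** A representative of [C] is not in the subfield, so [trace0_translate]
    applies to it and its one-dimensional solution space is a single coset. *)
Lemma card_singer_translate C : (C != 1)%g ->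
  #|[set X in singer_set | (C * X)%g \in singer_set]| = 1%N.
Proof.
rewrite -(coset_reprK C); set c := repr C => C1.
have cF : frob (val c) != val c.
  by apply: contraNneq C1 => cF; rewrite coset_id // inE cF.
have [y0 [y00 [ty0 tcy0]] y0_spans] := trace0_translate _ cF.
have uy0 : y0 \is a GRing.unit by rewrite unitfE.
pose u0 : {unit K} := Sub y0 uy0.
apply/eqP/cards1P; exists (coset base_units u0); apply/setP => X.
rewrite -(coset_reprK X); set x := repr X; rewrite inE finset.in_set1.
rewrite -morphM ?base_units_norm // !coset_singer !inE FinRing.val_unitM.
apply/andP/eqP => [[/eqP tx /eqP tcx]|xE].
  have [e eF xE] := y0_spans _ tx tcx.
  have ue : e \is a GRing.unit.
    by have := valP x; rewrite /= xE unitrM => /andP[].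
  pose v : {unit K} := Sub e ue.
  have -> : x = (v * u0)%g by apply: val_inj; rewrite FinRing.val_unitM !SubK.
  by rewrite coset_kerl // inE SubK eF.
have /rcosetP[e] : x \in (base_units :* u0)%g.
  by rewrite -val_coset ?base_units_norm // -xE val_coset ?base_units_norm // rcoset_refl.
rewrite inE => /eqP eF ->; rewrite FinRing.val_unitM SubK mulrCA !(traceZ _ _ eF).
by rewrite ty0 tcy0 mulr0.
Qed.
End Trace.

(** * The theorem *)

Lemma M_odd_prime_power q : prime_power q -> odd q ->
  (q ^ 2 + q + 1) ^ 2 <= M ((q + 1) ^ 2 + 1).
Proof.
case=> p [k [p_prime k_gt0 qE]] odd_q.
have q_gt1 : 1 < q by rewrite qE -(exp1n k) ltn_exp2r ?prime_gt1.
have k3_gt0 : 0 < k * 3 by rewrite muln_gt0 k_gt0.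
have [K charK] := pPrimePowerField p_prime k3_gt0.
rewrite expnM -qE => cardK.
have FrobD (x y : K) : ((x + y) ^+ q = x ^+ q + y ^+ q)%R.
  apply: exprDn_pchar; rewrite qE pnatX; apply/orP; left.
  by rewrite pnatE.
have cardG := card_singer_group _ _ q_gt1 cardK FrobD.
have cardA := card_singer_set _ _ q_gt1 cardK FrobD.
rewrite -cardG.
have -> : (q + 1) ^ 2 + 1 =
    #|{: coset_of (base_units K q)}| + #|singer_set K q|.
  by rewrite cardG cardA; lia.
apply: M_difference_set.
- by rewrite cardA addn1 /= odd_q.
- by rewrite cardG !oddD oddX odd_q.
- by move=> c c1; rewrite card_singer_translate.
- by rewrite cardA addn1.
Qed.

Local Open Scope classical_set_scope.
Local Open Scope ring_scope.

Lemma sqrB_sqrt_bigO (R : realType) :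
  (fun n : nat => n%:R ^+ 2 - (n%:R - Num.sqrt (n%:R - 1)) ^+ 2 : R^o)
    =O_\oo (fun n : nat => n%:R `^ (3 / 2) : R^o).
Proof.
apply/eqO_exP; exists 2; first by [].
near=> n.
have n1 : 1 <= n%:R :> R by rewrite ler1n; near: n; exists 1%N.
have pow : n%:R `^ (3 / 2) = n%:R * Num.sqrt n%:R :> R.
  have -> : 3 / 2 = 1 + 2^-1 :> R by field.
  rewrite powRD; last by rewrite (gt_eqF (lt_le_trans ltr01 n1)) implybT.
  by rewrite powRr1 ?powR12_sqrt ?ler0n.
rewrite pow; set m := n%:R : R; set s := Num.sqrt (m - 1).
have s0 : 0 <= s by apply: sqrtr_ge0.
have sE : s ^+ 2 = m - 1 by rewrite sqr_sqrtr // subr_ge0.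
have st : s <= Num.sqrt m by apply: ler_wsqrtr; rewrite lerBlDr lerDl.
have -> : m ^+ 2 - (m - s) ^+ 2 = 2 * m * s - (m - 1) by rewrite -sE; ring.
have m1 : 1 <= m by [].
have m0 : 0 <= m := le_trans ler01 m1.
have sm : s <= m by nra.
have lhs0 : 0 <= 2 * m * s - (m - 1) by rewrite -sE; nra.
have rhs0 : 0 <= m * Num.sqrt m by rewrite mulr_ge0 ?sqrtr_ge0 ?(le_trans ler01).
rewrite (ger0_norm lhs0) (ger0_norm rhs0).
move: (Num.sqrt m) st {rhs0 pow} => t st; nra.
Unshelve. all: by end_near. Qed.

Theorem theorem3 (R : realType) :
  (forall n q : nat, prime_power q -> odd q -> n = ((q + 1) ^ 2 + 1)%N ->
     (n%:R - Num.sqrt (n%:R - 1)) ^+ 2 <= (M n)%:R :> R) /\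
  (fun n : nat => n%:R ^+ 2 - (n%:R - Num.sqrt (n%:R - 1)) ^+ 2 : R^o)
    =O_\oo (fun n : nat => n%:R `^ (3 / 2) : R^o).
Proof.
split; last exact: sqrB_sqrt_bigO.
move=> n q q_pp odd_q ->.
have := M_odd_prime_power _ q_pp odd_q; rewrite -(ler_nat R); apply: le_trans.
rewrite natrD addrK natrX sqrtr_sqr ger0_norm ?ler0n //.
by rewrite le_eqVlt; apply/orP; left; rewrite natrX !natrD natrX; apply/eqP; ring.
Qed.
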